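(* For every integer $j\ge 0$ and all $x$, \[ F_{j+1}(x)=\frac{1}{2^j}\sum_{m=0}^{\left\lfloor j/2\right\rfloor}\binom{j}{m}\frac{j-2m+1}{j-m+1}\;{}_{2}F_{1}\!\left(\begin{matrix}-m,\ -j+m-1\\ -j\end{matrix}\,\Big|\,-4\right)U_{j-2m}(x). \]
   Context: The Fibonacci polynomials are defined by $F_0(x)=0$, $F_1(x)=1$, $F_{n+2}(x)=xF_{n+1}(x)+F_n(x)$ for $n\ge 0$. $U_n(x)$ denotes the Chebyshev polynomial of the second kind, $U_n(\cos\theta)=\sin((n+1)\theta)/\sin\theta$. For a nonnegative integer $m$, ${}_2F_1\!\left(\begin{smallmatrix}-m,\ b\\ c\end{smallmatrix}\big|z\right)=\sum_{k=0}^{m}\frac{(-m)_k(b)_k}{(c)_k\,k!}z^k$, where $(a)_k=a(a+1)\cdots(a+k-1)$. *)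

(* Defs.v *)
From mathcomp Require Export all_boot all_order all_algebra.
From mathcomp Require Export all_classical reals trigo.
From mathcomp Require Export complex.
From mathcomp Require Import ring lra.

Set Implicit Arguments.
Unset Strict Implicit.
Unset Printing Implicit Defensive.

Import Order.TTheory GRing.Theory Num.Theory.
Local Open Scope classical_set_scope.
Local Open Scope complex_scope.
Local Open Scope ring_scope.

Fixpoint fibonacci_poly (A : nzRingType) (n : nat) : {poly A} :=
  match n with
  | 0 => 0
  | 1 => 1
  | (n'.+1 as n1).+1 => 'X * fibonacci_poly A n1 + fibonacci_poly A n'
  end.

Definition is_chebyshevU (R : realType) (n : nat) (p : {poly R[i]}) : Prop :=
  forall t : R, sin t != 0 ->
    p.[(cos t)%:C] = (sin (n.+1%:R * t) / sin t)%:C.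

(* The default value 0 is never reached: [chebyshevUP] and
   [is_chebyshevU_unique] show that there is exactly one such polynomial. *)
Definition chebyshevU (R : realType) (n : nat) : {poly R[i]} :=
  xget 0 [set p | is_chebyshevU n p].

Definition pochhammer (A : nzRingType) (a : A) (k : nat) : A :=
  \prod_(i < k) (a + i%:R).

(* [hyp2F1 m b c z] is the terminating 2F1(-m, b; c | z): the first parameter
   is the nonnegative integer [m], the sign being supplied here. *)
Definition hyp2F1 (F : fieldType) (m : nat) (b c z : F) : F :=
  \sum_(k < m.+1)
    (pochhammer (- m%:R) k * pochhammer b k) / (pochhammer c k * k`!%:R)
      * z ^+ k.

Lemma is_chebyshevU_exists (R : realType) (n : nat) :
  exists p : {poly R[i]}, is_chebyshevU n p.
Proof.
pose P k := exists p : {poly R[i]}, is_chebyshevU k p.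
suff [] : P n /\ P n.+1 by [].
elim: n => [|n [[p Hp] [q Hq]]].
  split.
    by exists 1 => t st; rewrite hornerC mul1r divff.
  exists (2%:R *: 'X) => t st.
  rewrite hornerZ hornerX.
  have -> : 2%:R * t = t + t by ring.
  rewrite sinD.
  have -> : (2 : R[i]) = (2 : R)%:C by rewrite rmorph_nat.
  by rewrite -rmorphM /=; congr (_%:C); field.
split; first by exists q.
exists (2%:R *: 'X * q - p) => t st.
rewrite hornerD hornerN hornerM hornerZ hornerX Hp // Hq //.
have -> : (2 : R[i]) = (2 : R)%:C by rewrite rmorph_nat.
rewrite -!rmorphM -rmorphB /=; congr (_%:C).
set a := n.+2%:R * t.
have -> : n.+3%:R * t = a + t by rewrite /a -[n.+3]addn1 natrD; ring.
have -> : n.+1%:R * t = a - t by rewrite /a -[n.+2]addn1 natrD; ring.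
by rewrite !sinD cosN sinN; field.
Qed.

Lemma chebyshevUP (R : realType) (n : nat) : is_chebyshevU n (chebyshevU R n).
Proof.
exact: (xgetPex 0 (is_chebyshevU_exists R n)).
Qed.

Lemma is_chebyshevU_unique (R : realType) (n : nat) (p q : {poly R[i]}) :
  is_chebyshevU n p -> is_chebyshevU n q -> p = q.
Proof.
move=> Hp Hq; apply/eqP; rewrite -subr_eq0; apply/negPn/negP => nz.
pose s : seq R[i] :=
  [seq ((k.+2%:R : R)^-1)%:C | k <- iota 0 (size (p - q))].
have us : uniq s.
  rewrite map_inj_uniq ?iota_uniq // => k l /complexI /invr_inj /eqP.
  by rewrite eqr_nat => /eqP [].
have rs : all (root (p - q)) s.
  apply/allP => _ /mapP [k _ ->].
  set y := (k.+2%:R)^-1.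
  have y0 : 0 < y by rewrite invr_gt0 ltr0n.
  have y1 : y < 1 by rewrite invf_lt1 ?ltr0n // ltr1n.
  have yB : -1 <= y <= 1 by apply/andP; split; lra.
  have cy : cos (acos y) = y by case: (acos_def yB).
  have sy : sin (acos y) != 0.
    rewrite sin_acos // sqrtr_eq0 -ltNge; nra.
  by rewrite rootE hornerD hornerN -cy Hp // Hq // subrr.
have := max_poly_roots nz rs us.
by rewrite size_map size_iota ltnn.
Qed.

(* Main.v *)
(** Expand [F_(j+1)(x) = \sum_k 'C(j - k, k) x^(j - 2k)] and
    [(2x)^n = \sum_l ('C(n, l) - 'C(n, l - 1)) U_(n - 2l)(x)], substitute the
    second formula into the first and collect the terms with [m = k + l].  The
    coefficient of [U_(j - 2m)] is then a sum over [k], and it agrees with the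
    hypergeometric sum term by term. *)

Require Import Defs.
From mathcomp Require Import ring zify.
Import Order.TTheory GRing.Theory Num.Theory.
Local Open Scope ring_scope.

(** On coefficients, the Fibonacci recurrence is Pascal's rule. The range may exceed [j / 2]: for
    [2 * k > j] the binomial vanishes, so the truncated exponent is harmless. *)
Lemma fibonacci_polyS_sum (A : comNzRingType) (j : nat) (x : A) :
  (fibonacci_poly A j.+1).[x] =
  \sum_(0 <= k < j.+1) 'C(j - k, k)%:R * x ^+ (j - 2 * k).
Proof.
pose P j := (fibonacci_poly A j.+1).[x] =
  \sum_(0 <= k < j.+1) 'C(j - k, k)%:R * x ^+ (j - 2 * k).
suff [] : P j /\ P j.+1 by [].
elim: j => [|j [IH0 IH1]].
  split; rewrite /P /=.
    by rewrite big_nat1 hornerC bin0 expr0 mulr1.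
  by rewrite big_nat_recr //= big_nat1 !hornerE.
split=> //; rewrite /P.
have -> : fibonacci_poly A j.+3 =
  'X * fibonacci_poly A j.+2 + fibonacci_poly A j.+1 by [].
rewrite hornerD hornerM hornerX IH0 IH1.
rewrite [RHS]big_nat_recl // [in RHS]big_nat_recr //= subnn bin0n mul0r addr0.
rewrite [in X in x * X + _]big_nat_recl //= mulrDr -addrA !bin0 !mul1r.
rewrite !muln0 !subn0 -exprS; congr (_ + _).
rewrite mulr_sumr.
have -> : \sum_(0 <= i < j.+1) x * ('C(j.+1 - i.+1, i.+1)%:R *
    x ^+ (j.+1 - 2 * i.+1)) =
  \sum_(0 <= i < j.+1) 'C(j - i, i.+1)%:R * x ^+ (j - 2 * i) :> A.
  rewrite !big_nat; apply: eq_bigr => i _; rewrite subSS.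
  (* The exponents match only if [2 * i < j]; otherwise both binomials are zero. *)
  have [le_ij|lt_ji] := leqP (2 * i).+1 j.
    have -> : (j - 2 * i = (j.+1 - 2 * i.+1).+1)%N by lia.
    by rewrite exprS; ring.
  by rewrite bin_small ?mul0r ?mulr0 //; lia.
rewrite -big_split /= !big_nat; apply: eq_bigr => i /andP[_ le_ij].
have -> : (j.+2 - i.+1 = (j - i).+1)%N by lia.
have -> : (j.+2 - 2 * i.+1 = j - 2 * i)%N by lia.
by rewrite binS natrD mulrDl.
Qed.

(** Ballot numbers, with 'C(n, -1) read as 0. The difference is taken in the ring because it is
    negative for some [l] beyond the middle. *)
Definition ballot (A : nzRingType) (n l : nat) : A :=
  'C(n, l)%:R - (if l is l'.+1 then 'C(n, l') else 0%N)%:R.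

Lemma ballotSS (A : nzRingType) (n l : nat) :
  ballot A n.+1 l.+1 = ballot A n l.+1 + ballot A n l.
Proof.
rewrite /ballot binS natrD; case: l => [|l].
  by rewrite !bin0 subr0 addrAC.
by rewrite binS natrD opprD addrACA.
Qed.

(** By symmetry of the binomial row. This is the boundary case where truncated indices would
    otherwise break the Chebyshev recurrence. *)
Lemma ballot_half_eq0 (A : nzRingType) (l : nat) :
  ballot A (2 * l).+1 l.+1 = 0.
Proof.
rewrite /ballot -bin_sub; last by lia.
have -> : ((2 * l).+1 - l.+1 = l)%N by lia.
by rewrite subrr.
Qed.

(** The closed form of the ballot number with its denominator cleared, from (l + 1) 'C(n, l + 1) =
    (n - l) 'C(n, l). *)
Lemma ballotM (A : comNzRingType) (n l : nat) : (l <= n)%N ->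
  ballot A n l * (n%:R - l%:R + 1) = 'C(n, l)%:R * (n%:R - 2 * l%:R + 1).
Proof.
rewrite /ballot; case: l => [|l] ln.
  by rewrite subr0 mulr0.
have /(congr1 (fun k => k%:R : A)) := mul_bin_left n l.
rewrite !natrM natrB; last by lia.
rewrite -[in l.+1%:R](addn1 l) natrD => E.
have -> : (n%:R - (l%:R + 1) + 1 : A) = n%:R - l%:R by ring.
rewrite mulrBl [X in _ - X]mulrC -E; ring.
Qed.

(* [V n.+1] is [U_n(x)]; starting at [V 0 = 0] makes the terms with
   [n < 2 * l], where the index is truncated to [0], vanish. *)
Lemma expr_ballot_sum (A : comNzRingType) (x : A) (V : nat -> A) (n : nat) :
    V 0%N = 0 -> V 1%N = 1 ->
    (forall k, 2 * x * V k.+1 = V k.+2 + V k) ->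
  (2 * x) ^+ n = \sum_(0 <= l < n.+1) ballot A n l * V (n.+1 - 2 * l)%N.
Proof.
move=> V0 V1 VS; elim: n => [|n IH].
  by rewrite big_nat1 /ballot bin0 V1 subr0 mulr1.
rewrite exprS IH mulr_sumr.
have E l : 2 * x * (ballot A n l * V (n.+1 - 2 * l)%N) =
    ballot A n l * V (n.+2 - 2 * l)%N + ballot A n l * V (n - 2 * l)%N.
  rewrite mulrCA; have [le_ln|lt_nl] := leqP (2 * l) n.
    have -> : (n.+1 - 2 * l = (n - 2 * l).+1)%N by lia.
    have -> : (n.+2 - 2 * l = (n - 2 * l).+2)%N by lia.
    by rewrite VS mulrDr.
  have [-> -> ] : (n.+1 - 2 * l = 0)%N /\ (n - 2 * l = 0)%N by lia.
  (* The left side is now 0. The right side involves [V 1] only if [2 * l = n + 1], and there the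
     ballot number vanishes. *)
  rewrite V0 !mulr0 addr0; have [le_l|lt_l] := leqP n.+2 (2 * l).
    have -> : (n.+2 - 2 * l = 0)%N by lia.
    by rewrite V0 mulr0.
  case: l lt_nl lt_l => [|l] lt_nl lt_l; first by lia.
  have -> : n = (2 * l).+1 by lia.
  by rewrite ballot_half_eq0 mul0r.
rewrite (eq_bigr _ (fun l _ => E l)) big_split /=.
rewrite [RHS]big_nat_recl // [in X in X + _]big_nat_recl //.
rewrite -addrA; congr (_ + _); first by rewrite /ballot !bin0.
(* The extra term [l = n] carries [V 0]; the ranges now agree and [ballotSS] merges the sums. *)
have -> : \sum_(0 <= l < n) ballot A n l.+1 * V (n.+2 - 2 * l.+1)%N =
    \sum_(0 <= l < n.+1) ballot A n l.+1 * V (n.+2 - 2 * l.+1)%N.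
  rewrite [RHS]big_nat_recr //=.
  case: n {IH E} => [|n]; first by rewrite V0 mulr0 addr0.
  have -> : (n.+3 - 2 * n.+2 = 0)%N by lia.
  by rewrite V0 mulr0 addr0.
rewrite -big_split /=; apply: eq_bigr => l _.
have -> : (n - 2 * l = n.+2 - 2 * l.+1)%N by lia.
by rewrite ballotSS [RHS]mulrDl.
Qed.

(** [chebyshevU] is chosen by its values at cosines and does not compute, so initial values and
    recurrence are recovered by uniqueness. *)
Lemma chebyshevU0 (R : realType) : chebyshevU R 0 = 1.
Proof.
apply: (@is_chebyshevU_unique R 0) => [|t st]; first exact: chebyshevUP.
by rewrite hornerC mul1r divff.
Qed.

Lemma chebyshevU1 (R : realType) : chebyshevU R 1 = 2 *: 'X.
Proof.
apply: (@is_chebyshevU_unique R 1) => [|t st]; first exact: chebyshevUP.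
have -> : 2%:R * t = t + t by ring.
rewrite hornerZ hornerX sinD.
have -> : (2 : R[i]) = (2 : R)%:C%C by rewrite rmorph_nat.
by rewrite -rmorphM /=; congr (_%:C)%C; field.
Qed.

Lemma chebyshevUSS (R : realType) (n : nat) :
  chebyshevU R n.+2 = 2 *: 'X * chebyshevU R n.+1 - chebyshevU R n.
Proof.
apply: (@is_chebyshevU_unique R n.+2) => [|t st]; first exact: chebyshevUP.
rewrite hornerD hornerN hornerM hornerZ hornerX !chebyshevUP //.
have -> : (2 : R[i]) = (2 : R)%:C%C by rewrite rmorph_nat.
rewrite -!rmorphM -rmorphB /=; congr (_%:C)%C.
(* The recurrence becomes sin(a + t) + sin(a - t) = 2 cos t sin a. *)
set a := n.+2%:R * t.
have -> : n.+3%:R * t = a + t by rewrite /a -[n.+3]addn1 natrD; ring.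
have -> : n.+1%:R * t = a - t by rewrite /a -[n.+2]addn1 natrD; ring.
by rewrite !sinD cosN sinN; field.
Qed.

Lemma pochhammerN (A : comNzRingType) (n k : nat) :
  pochhammer (- n%:R : A) k = (- 1) ^+ k * (n ^_ k)%:R.
Proof.
rewrite /pochhammer; elim: k => [|k IH].
  by rewrite big_ord0 ffactn0 expr0 mulr1.
rewrite big_ord_recr /= IH ffactnSr natrM exprS.
have [le_kn|lt_nk] := leqP k n; first by rewrite natrB //; ring.
by rewrite ffact_small // !(mul0r, mulr0).
Qed.

Lemma bin_factE (F : numFieldType) (n k : nat) :
  'C(n + k, k)%:R = (n + k)`!%:R / (k`!%:R * n`!%:R) :> F.
Proof.
have := bin_fact (leq_addl n k); rewrite addnK => <-.
by rewrite !natrM mulfK // mulf_neq0 // pnatr_eq0 -lt0n fact_gt0.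
Qed.

Lemma ffact_factE (F : numFieldType) (n k : nat) :
  ((n + k) ^_ k)%:R = (n + k)`!%:R / n`!%:R :> F.
Proof.
have := ffact_fact (leq_addl n k); rewrite addnK => <-.
by rewrite natrM mulfK // pnatr_eq0 -lt0n fact_gt0.
Qed.

Lemma hyp2F1_term (F : numFieldType) (j m k : nat) :
    (2 * m <= j)%N -> (k <= m)%N ->
  'C(j, m)%:R * ((j%:R - 2 * m%:R + 1) / (j%:R - m%:R + 1)) *
  ((pochhammer (- m%:R) k * pochhammer (- j%:R + m%:R - 1) k) /
   (pochhammer (- j%:R) k * k`!%:R) * (- 4) ^+ k) =
  4 ^+ k * 'C(j - k, k)%:R * ballot F (j - 2 * k) (m - k) :> F.
Proof.
move=> le_mj le_km.
(* In terms of [l = m - k] and [d = j - 2 * m], all quantities are factorials of sums, free of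
   truncated subtraction. *)
have [l Em] : exists l, m = (l + k)%N by exists (m - k)%N; lia.
have [d Ej] : exists d, j = (d + 2 * m)%N by exists (j - 2 * m)%N; lia.
subst m j; set j := (d + 2 * (l + k))%N.
have fact0 n : n`!%:R != 0 :> F by rewrite pnatr_eq0 -lt0n fact_gt0.
have nz n : n%:R + 1 != 0 :> F by rewrite natr1 pnatr_eq0.
(* Now all three Pochhammer symbols start at the opposite of a natural number, as [pochhammerN]
   requires. *)
have -> : - j%:R + (l + k)%:R - 1 = - (d + l + 1 + k)%:R :> F.
  by rewrite /j !(natrD, natrM); ring.
rewrite !pochhammerN -[- 4]mulN1r exprMn.
have -> : ballot F (j - 2 * k) (l + k - k) =
    'C(d + l + l, l)%:R * ((d%:R + 1) / ((d + l)%:R + 1)).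
  have -> : (j - 2 * k = d + l + l)%N by rewrite /j; lia.
  rewrite addnK; apply: (mulIf (nz (d + l)%N)).
  have := @ballotM F (d + l + l) l (leq_addl _ _).
  have -> : (d + l + l)%:R - l%:R + 1 = (d + l)%:R + 1 :> F.
    by rewrite !natrD; ring.
  by move=> ->; rewrite mulrA mulfVK ?nz // !natrD; congr (_ * _); ring.
have -> : j%:R - 2 * (l + k)%:R + 1 = d%:R + 1 :> F.
  by rewrite /j !(natrD, natrM); ring.
have -> : j%:R - (l + k)%:R + 1 = (d + l + k)%:R + 1 :> F.
  by rewrite /j !(natrD, natrM); ring.
have -> : (j - k = d + l + l + k)%N by rewrite /j; lia.
have Ej1 : j = (d + l + k + (l + k))%N by rewrite /j; lia.
have Ej2 : j = (d + l + l + k + k)%N by rewrite /j; lia.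
rewrite [in 'C(j, _)]Ej1 [in j ^_ k]Ej2 !bin_factE !ffact_factE -Ej1 -Ej2.
have -> : (d + l + 1 + k = (d + l + k).+1)%N by lia.
have -> : (d + l + 1 = (d + l).+1)%N by lia.
rewrite !factS !natrM -[(d + l + k).+1%:R]natr1 -[(d + l).+1%:R]natr1.
have := fact0 j; have := fact0 (l + k)%N; have := fact0 (d + l + k)%N.
have := fact0 l; have := fact0 (d + l)%N; have := fact0 k.
have := fact0 (d + l + l)%N; have := fact0 (d + l + l + k)%N.
have := nz (d + l)%N; have := nz (d + l + k)%N.
have s2 : (- 1) ^+ k * (- 1) ^+ k = 1 :> F.
  by rewrite -exprMn mulrNN mulr1 expr1n.
have s0 : (- 1) ^+ k != 0 :> F by rewrite expf_neq0 // oppr_eq0 oner_eq0.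
(* With powers and factorials made opaque, a rational identity remains; the signs on the left
   combine to [s * s], so the same factor is inserted on the right. *)
move: s2 s0; move: ((- 1) ^+ k) (4 ^+ k) => s q s2 s0.
move: (j`!%:R) ((l + k)`!%:R) ((d + l + k)`!%:R) (l`!%:R) ((d + l)`!%:R)
  (k`!%:R) ((d + l + l)`!%:R) ((d + l + l + k)`!%:R) ((d + l)%:R)
  ((d + l + k)%:R) (d%:R) => a1 a2 a3 a4 a5 a6 a7 a8 a9 a10 a11.
move=> *; rewrite -[q in RHS]mul1r -s2; field.
by rewrite s2; do ?[apply/andP; split].
Qed.

Theorem theorem4 (R : realType) (j : nat) (x : R[i]) :
  (fibonacci_poly R[i] j.+1).[x] =
  1 / 2 ^+ j *
  \sum_(0 <= m < (j %/ 2).+1)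
    'C(j, m)%:R * ((j%:R - 2 * m%:R + 1) / (j%:R - m%:R + 1))
    * hyp2F1 m (- j%:R + m%:R - 1) (- j%:R) (- 4)
    * (chebyshevU R (j - 2 * m)).[x].
Proof.
pose V n := if n is n'.+1 then (chebyshevU R n').[x] else 0.
have V1 : V 1%N = 1 by rewrite /V chebyshevU0 hornerC.
have VS k : 2 * x * V k.+1 = V k.+2 + V k.
  case: k => [|k]; rewrite /V.
    by rewrite chebyshevU0 chebyshevU1 !hornerE.
  by rewrite chebyshevUSS !hornerE subrK.
have E n := @expr_ballot_sum _ x V n erefl V1 VS.
have nz2 : 2 ^+ j != 0 :> R[i] by rewrite expf_neq0 // pnatr_eq0.
apply: (mulfI nz2); rewrite mulrA div1r mulfV // mul1r.
rewrite fibonacci_polyS_sum mulr_sumr.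
set N := (j %/ 2).+1.
have -> : \sum_(0 <= k < j.+1) 2 ^+ j * ('C(j - k, k)%:R * x ^+ (j - 2 * k)) =
  \sum_(0 <= k < N) \sum_(0 <= m < N | (k <= m)%N)
    4 ^+ k * 'C(j - k, k)%:R * ballot R[i] (j - 2 * k) (m - k)
    * V (j - 2 * m).+1.
  (* For [k >= N], [2 * k > j] and the binomial is zero. *)
  rewrite (@big_cat_nat _ _ _ N) //=; last by rewrite /N; lia.
  rewrite [X in _ + X]big_nat [X in _ + X]big1 ?addr0; last first.
    by move=> k; rewrite /N => kN; rewrite bin_small ?mul0r ?mulr0 //; lia.
  rewrite !big_nat; apply: eq_bigr => k kN.
  have -> : 2 ^+ j * ('C(j - k, k)%:R * x ^+ (j - 2 * k)) =
      4 ^+ k * 'C(j - k, k)%:R * (2 * x) ^+ (j - 2 * k).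
    have {1}-> : (j = 2 * k + (j - 2 * k))%N by rewrite /N in kN; lia.
    rewrite exprD exprM [(2 * x) ^+ _]exprMn.
    have -> : 2 ^+ 2 = 4 :> R[i] by ring.
    by ring.
  (* For [l >= N - k] the index of [V] truncates to 0; the remaining terms are reindexed by
     [m = k + l]. *)
  rewrite E (@big_cat_nat _ _ _ (N - k)) //=; last by rewrite /N in kN *; lia.
  rewrite [X in _ + X]big_nat [X in _ + X]big1 ?addr0; last first.
    move=> l lN; suff -> : ((j - 2 * k).+1 - 2 * l = 0)%N by rewrite mulr0.
    by rewrite /N in kN lN; lia.
  transitivity (\sum_(0 + k <= m < N)
    4 ^+ k * 'C(j - k, k)%:R * ballot R[i] (j - 2 * k) (m - k)
    * V (j - 2 * m).+1); last by rewrite (@big_nat_widenl _ _ _ _ 0).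
  rewrite big_addn mulr_sumr !big_nat; apply: eq_bigr => l lN.
  rewrite addnK mulrA; congr (_ * V _).
  by rewrite /N in kN lN; lia.
rewrite (exchange_big_dep_nat xpredT) //= [LHS]big_nat [RHS]big_nat.
apply: eq_bigr => m mN.
rewrite -mulr_suml; congr (_ * _); rewrite /hyp2F1 mulr_sumr.
rewrite -(big_mkord xpredT (fun k => 'C(j, m)%:R *
  ((j%:R - 2 * m%:R + 1) / (j%:R - m%:R + 1)) *
  ((pochhammer (- m%:R) k * pochhammer (- j%:R + m%:R - 1) k) /
   (pochhammer (- j%:R) k * k`!%:R) * (- 4) ^+ k))).
(* The hypergeometric sum is widened to [k < N] under the condition [k <= m], matching the exchanged
   triangular sum. *)
rewrite [RHS](@big_nat_widen _ _ _ _ _ N) //=.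
rewrite big_nat_cond [RHS]big_nat_cond; apply: eq_bigr => k /andP[_ le_km].
by rewrite hyp2F1_term //; rewrite /N in mN; lia.
Qed.
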